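(* Let $f\colon X\to X$ be an expansive homeomorphism of a compact metric space $X$. Then $f$ admits a catenary local metric.
   Context: A homeomorphism $f$ of a compact metric space $(X,\operatorname{dist})$ is expansive if there is $\delta>0$ such that $\operatorname{dist}(f^n(x),f^n(y))\le\delta$ for all $n\in\mathbb{Z}$ implies $x=y$. Let $X^3_\delta=\{(x,y,z)\in X^3: y,z\in B_\delta(x)\}$, where $B_\delta(x)$ is the open ball of radius $\delta$ about $x$. A local metric on $X$ is a continuous function $D\colon X^3_\delta\to\mathbb{R}$ (for some $\delta>0$), written $D(x,y,z)=D_x(y,z)$, such that: (1) each $D_x$ is a metric on $B_\delta(x)$; (2) $D_x(x,y)=D_y(x,y)$ whenever $\operatorname{dist}(x,y)<\delta$. It is catenary if $\ddot D_x=D_x$ for all $x$, where $\ddot D_x(y,z)=D_{f(x)}(f(y),f(z))-2D_x(y,z)+D_{f^{-1}(x)}(f^{-1}(y),f^{-1}(z))$ whenever all these terms are defined. *)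

(* Defs.v *)
From Stdlib Require Import Reals ZArith List.
Open Scope R_scope.

Set Implicit Arguments.

Definition is_metric (X : Type) (dist : X -> X -> R) : Prop :=
  (forall x y, 0 <= dist x y) /\
  (forall x y, dist x y = 0 <-> x = y) /\
  (forall x y, dist x y = dist y x) /\
  (forall x y z, dist x z <= dist x y + dist y z).

Definition is_open (X : Type) (dist : X -> X -> R) (U : X -> Prop) : Prop :=
  forall x, U x -> exists r, 0 < r /\ forall y, dist x y < r -> U y.

Definition compact_space (X : Type) (dist : X -> X -> R) : Prop :=
  forall (I : Type) (U : I -> X -> Prop),
    (forall i, is_open dist (U i)) ->
    (forall x, exists i, U i x) ->
    exists l : list I, forall x, exists i, In i l /\ U i x.

Definition continuous_map (X : Type) (dist : X -> X -> R) (f : X -> X) : Prop :=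
  forall x eps, 0 < eps -> exists eta, 0 < eta /\
    forall y, dist x y < eta -> dist (f x) (f y) < eps.

Definition homeomorphism_with_inverse (X : Type) (dist : X -> X -> R)
    (f g : X -> X) : Prop :=
  continuous_map dist f /\ continuous_map dist g /\
  (forall x, g (f x) = x) /\ (forall x, f (g x) = x).

Definition zpow (X : Type) (f g : X -> X) (n : Z) (x : X) : X :=
  match n with
  | Z0 => x
  | Zpos p => Nat.iter (Pos.to_nat p) f x
  | Zneg p => Nat.iter (Pos.to_nat p) g x
  end.

Definition expansive (X : Type) (dist : X -> X -> R) (f g : X -> X) : Prop :=
  exists delta, 0 < delta /\
    forall x y, (forall n : Z, dist (zpow f g n x) (zpow f g n y) <= delta) ->
      x = y.

Definition in_X3 (X : Type) (dist : X -> X -> R) (delta : R) (x y z : X) : Prop :=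
  dist x y < delta /\ dist x z < delta.

(* Continuity of D : X^3_delta -> R (product of metrics, relative topology).
   D is a total function; its values off X^3_delta are irrelevant. *)
Definition continuous_on_X3 (X : Type) (dist : X -> X -> R) (delta : R)
    (D : X -> X -> X -> R) : Prop :=
  forall x y z, in_X3 dist delta x y z ->
    forall eps, 0 < eps -> exists eta, 0 < eta /\
      forall x' y' z', in_X3 dist delta x' y' z' ->
        dist x x' < eta -> dist y y' < eta -> dist z z' < eta ->
        Rabs (D x' y' z' - D x y z) < eps.

(* Local metric D with D x y z = D_x(y,z), defined on X^3_delta. *)
Definition local_metric (X : Type) (dist : X -> X -> R) (delta : R)
    (D : X -> X -> X -> R) : Prop :=
  0 < delta /\
  continuous_on_X3 dist delta D /\
  (forall x y z, dist x y < delta -> dist x z < delta -> 0 <= D x y z) /\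
  (forall x y z, dist x y < delta -> dist x z < delta -> (D x y z = 0 <-> y = z)) /\
  (forall x y z, dist x y < delta -> dist x z < delta -> D x y z = D x z y) /\
  (forall x y z w, dist x y < delta -> dist x z < delta -> dist x w < delta ->
      D x y w <= D x y z + D x z w) /\
  (forall x y, dist x y < delta -> D x x y = D y x y).

(* Catenary: ddot D_x(y,z) = D_x(y,z) whenever all terms are defined. *)
Definition catenary (X : Type) (dist : X -> X -> R) (f g : X -> X) (delta : R)
    (D : X -> X -> X -> R) : Prop :=
  forall x y z,
    in_X3 dist delta x y z ->
    in_X3 dist delta (f x) (f y) (f z) ->
    in_X3 dist delta (g x) (g y) (g z) ->
    D (f x) (f y) (f z) - 2 * D x y z + D (g x) (g y) (g z) = D x y z.

(* Main.v *)
Require Import Defs.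
From Stdlib Require Import Reals.
From Stdlib Require Import Lra.
From Coquelicot Require Import Coquelicot.
Open Scope R_scope.

(** Let [h_x] be the (truncated) pseudometric obtained from [dist] by collapsing
    the [delta]-ball about [x] to a point, and let [mu < 1] be the root of
    [mu + 1 / mu = 3].  Up to the multiplicity of the index [0], which is
    harmless because [h] vanishes on [X^3_delta],
    [D_x(y,z) = sum_(n in Z) mu^|n| h_(f^n x)(f^n y, f^n z)].
    The kernel [mu^|n|] is a multiple of the Green function of
    [a_(n+1) - 2 a_n + a_(n-1) = a_n], so [D] is catenary where [h] vanishes, and
    expansivity with constant [2 delta] makes [D_x] separate points. *)

(** * The decay rate, the collapsed pseudometric and its weighted sums along orbits *)

Definition mu : R := (3 - sqrt 5) / 2.

Lemma mu_bounds : 0 < mu < 1.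
Proof.
  assert (H := sqrt_sqrt 5 ltac:(lra)). assert (H0 := sqrt_pos 5).
  unfold mu. split; nra.
Qed.

Lemma mu_root : mu * mu = 3 * mu - 1.
Proof.
  assert (H := sqrt_sqrt 5 ltac:(lra)). unfold mu. nra.
Qed.

Definition excess (X : Type) (dist : X -> X -> R) (delta : R) (x y : X) : R :=
  Rmax 0 (dist x y - delta).

(** The inner minimum compares two routes from [y] to [z]: the direct one and the one through the
    collapsed ball. The cap at 1 lets a geometric series dominate the sums along orbits. *)
Definition collapse (X : Type) (dist : X -> X -> R) (delta : R) (x y z : X) : R :=
  Rmin 1 (Rmin (dist y z) (excess X dist delta x y + excess X dist delta x z)).

Definition orbit_series (X : Type) (F : X -> X) (h : X -> X -> X -> R)
    (x y z : X) : R :=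
  Series (fun n => mu ^ n * h (Nat.iter n F x) (Nat.iter n F y) (Nat.iter n F z)).

Arguments excess {X}.
Arguments collapse {X}.
Arguments orbit_series {X}.

(** * Metric properties of the collapsed pseudometric *)

Section Collapse.

Context {X : Type} {dist : X -> X -> R} (delta : R) (Hm : is_metric dist).

Lemma excess_ge0 x y : 0 <= excess dist delta x y.
Proof. apply Rmax_l. Qed.

Lemma excess_lipschitz x y x' y' :
  excess dist delta x y <= excess dist delta x' y' + dist x x' + dist y y'.
Proof.
  destruct Hm as (Hp & _ & Hs & Ht).
  assert (H1 := Hp x x'). assert (H2 := Hp y y').
  assert (H3 := Ht x x' y). assert (H4 := Ht x' y' y).
  assert (H5 := Hs y y').
  unfold excess, Rmax. repeat destruct Rle_dec; lra.
Qed.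

Lemma collapse_bounds x y z : 0 <= collapse dist delta x y z <= 1.
Proof.
  destruct Hm as (Hp & _ & _ & _).
  assert (H1 := Hp y z).
  assert (H2 := excess_ge0 x y). assert (H3 := excess_ge0 x z).
  unfold collapse, Rmin. repeat destruct Rle_dec; lra.
Qed.

Lemma collapse_diag x y : collapse dist delta x y y = 0.
Proof.
  destruct Hm as (_ & H0 & _ & _).
  assert (H1 := proj2 (H0 y y) eq_refl). assert (H2 := excess_ge0 x y).
  unfold collapse, Rmin. rewrite H1. repeat destruct Rle_dec; lra.
Qed.

Lemma collapse_sym x y z : collapse dist delta x y z = collapse dist delta x z y.
Proof.
  destruct Hm as (_ & _ & Hs & _).
  unfold collapse. now rewrite (Hs y z), (Rplus_comm (excess _ _ x y)).
Qed.

(** If both legs are direct, this is the triangle inequality of [dist]. If exactly one leg passes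
    through the ball, the direct leg is absorbed because [excess] is 1-Lipschitz; if both do, the
    detour to [z] only adds length. *)
Lemma collapse_triangle x y z w :
  collapse dist delta x y w
  <= collapse dist delta x y z + collapse dist delta x z w.
Proof.
  assert (Hm' := Hm). destruct Hm' as (Hp & H0 & Hs & Ht).
  assert (H1 := Ht y z w). assert (H2 := Hp y z). assert (H3 := Hp z w).
  assert (H4 := excess_ge0 x y). assert (H5 := excess_ge0 x z).
  assert (H6 := excess_ge0 x w).
  assert (H7 := excess_lipschitz x y x z). assert (H8 := excess_lipschitz x w x z).
  rewrite (proj2 (H0 x x) eq_refl), ?(Hs w z) in *.
  unfold collapse, Rmin. repeat destruct Rle_dec; lra.
Qed.

(** A centre has no excess relative to itself, so both sides involve only the excess between [x] and
    [y], which is symmetric. *)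
Lemma collapse_base x y : 0 < delta ->
  collapse dist delta x x y = collapse dist delta y x y.
Proof.
  intros Hd. destruct Hm as (_ & H0 & Hs & _).
  unfold collapse, excess.
  rewrite (proj2 (H0 x x) eq_refl), (proj2 (H0 y y) eq_refl), (Hs y x).
  now rewrite (Rplus_comm (Rmax 0 (0 - delta))).
Qed.

Lemma collapse_in_X3 x y z :
  in_X3 dist delta x y z -> collapse dist delta x y z = 0.
Proof.
  intros [H1 H2]. destruct Hm as (Hp & _ & _ & _). assert (H3 := Hp y z).
  unfold collapse, excess.
  rewrite (Rmax_left 0 (dist x y - delta)), (Rmax_left 0 (dist x z - delta)) by lra.
  unfold Rmin. repeat destruct Rle_dec; lra.
Qed.

(** Either [dist y z] vanishes, or both excesses do and the two points lie within [delta] of [x]. *)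
Lemma collapse_eq0_dist x y z : 0 < delta ->
  collapse dist delta x y z = 0 -> dist y z <= 2 * delta.
Proof.
  intros Hd H. destruct Hm as (Hp & _ & Hs & Ht).
  assert (H1 := Ht y x z). assert (H2 := Hs y x).
  revert H. unfold collapse, excess, Rmin, Rmax.
  repeat destruct Rle_dec; lra.
Qed.

(** The base point carries weight 2 because it enters both excess terms. *)
Lemma collapse_lipschitz x y z x' y' z' :
  collapse dist delta x y z
  <= collapse dist delta x' y' z' + 2 * dist x x' + dist y y' + dist z z'.
Proof.
  assert (H1 := excess_lipschitz x y x' y').
  assert (H2 := excess_lipschitz x z x' z').
  destruct Hm as (Hp & _ & Hs & Ht).
  assert (H3 := Hp x x'). assert (H4 := Hp y y'). assert (H5 := Hp z z').
  assert (H6 := Ht y y' z). assert (H7 := Ht y' z' z). assert (H8 := Hs z z').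
  unfold collapse, Rmin. repeat destruct Rle_dec; lra.
Qed.

Lemma collapse_continuous x y z eps : 0 < eps ->
  exists eta, 0 < eta /\ forall x' y' z',
    dist x x' < eta -> dist y y' < eta -> dist z z' < eta ->
    Rabs (collapse dist delta x' y' z' - collapse dist delta x y z) <= eps.
Proof.
  intros He. exists (eps / 4). split; [lra|]. intros x' y' z' Hx Hy Hz.
  assert (H1 := collapse_lipschitz x y z x' y' z').
  assert (H2 := collapse_lipschitz x' y' z' x y z).
  destruct Hm as (_ & _ & Hs & _).
  rewrite (Hs x' x), (Hs y' y), (Hs z' z) in H2.
  apply Rabs_le. lra.
Qed.

End Collapse.

(** * One-sided weighted sums of a bounded kernel along orbits *)

Section OrbitSeries.

Context {X : Type} (F : X -> X) {h : X -> X -> X -> R}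
  (hb : forall x y z, 0 <= h x y z <= 1).

Lemma ex_series_orbit x y z :
  ex_series (fun n => mu ^ n * h (Nat.iter n F x) (Nat.iter n F y) (Nat.iter n F z)).
Proof.
  apply (@ex_series_le R_AbsRing R_CompleteNormedModule _ (fun n => mu ^ n)).
  - intros n. change norm with Rabs; simpl.
    assert (H := pow_lt mu n (proj1 mu_bounds)).
    assert (H1 := hb (Nat.iter n F x) (Nat.iter n F y) (Nat.iter n F z)).
    rewrite Rabs_pos_eq; nra.
  - apply ex_series_geom. assert (H := mu_bounds). rewrite Rabs_pos_eq; lra.
Qed.

Lemma orbit_series_bounds x y z : 0 <= orbit_series F h x y z <= / (1 - mu).
Proof.
  assert (Hmu := mu_bounds). split.
  - replace 0 with (Series (fun n => 0 * 0)) by (rewrite Series_scal_l; lra).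
    apply Series_le; [|apply ex_series_orbit].
    intros n. assert (H := pow_lt mu n (proj1 mu_bounds)).
    assert (H1 := hb (Nat.iter n F x) (Nat.iter n F y) (Nat.iter n F z)). nra.
  - rewrite <- (Series_geom mu) by (rewrite Rabs_pos_eq; lra).
    apply Series_le; [|apply ex_series_geom; rewrite Rabs_pos_eq; lra].
    intros n. assert (H := pow_lt mu n (proj1 mu_bounds)).
    assert (H1 := hb (Nat.iter n F x) (Nat.iter n F y) (Nat.iter n F z)). nra.
Qed.

(** Splitting off index 0 gives a recursion on which the vanishing, continuity and catenary
    arguments all rest. *)
Lemma orbit_series_step x y z :
  orbit_series F h x y z = h x y z + mu * orbit_series F h (F x) (F y) (F z).
Proof.
  unfold orbit_series at 1. rewrite Series_incr_1 by apply ex_series_orbit.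
  unfold orbit_series. rewrite <- Series_scal_l. f_equal; [simpl; ring|].
  apply Series_ext; intros n. rewrite !Nat.iter_succ_r. simpl. ring.
Qed.

Lemma orbit_series_eq0 x y z n : orbit_series F h x y z = 0 ->
  h (Nat.iter n F x) (Nat.iter n F y) (Nat.iter n F z) = 0.
Proof.
  revert x y z. induction n as [|n IH]; intros x y z H;
    rewrite orbit_series_step in H;
    assert (H1 := hb x y z);
    assert (H2 := orbit_series_bounds (F x) (F y) (F z));
    assert (H3 := mu_bounds).
  - simpl. nra.
  - rewrite !Nat.iter_succ_r. apply IH. nra.
Qed.

Lemma orbit_series_diag x y :
  (forall x y, h x y y = 0) -> orbit_series F h x y y = 0.
Proof.
  intros H. unfold orbit_series.
  rewrite <- (Rmult_0_l (Series (fun n => 0))), <- Series_scal_l.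
  apply Series_ext. intros n. rewrite H. ring.
Qed.

Lemma orbit_series_triangle x y z w :
  (forall x y z w, h x y w <= h x y z + h x z w) ->
  orbit_series F h x y w <= orbit_series F h x y z + orbit_series F h x z w.
Proof.
  intros H. unfold orbit_series.
  rewrite <- Series_plus by apply ex_series_orbit.
  apply Series_le.
  - intros n. assert (H1 := pow_lt mu n (proj1 mu_bounds)).
    rewrite <- Rmult_plus_distr_l. split.
    + apply Rmult_le_pos; [lra|apply hb].
    + apply Rmult_le_compat_l; [lra|apply H].
  - apply (@ex_series_plus R_AbsRing R_NormedModule); apply ex_series_orbit.
Qed.

(** * Continuity of the weighted sums *)

Context {dist : X -> X -> R} (HF : continuous_map dist F)
  (hc : forall x y z eps, 0 < eps -> exists eta, 0 < eta /\ forall x' y' z',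
    dist x x' < eta -> dist y y' < eta -> dist z z' < eta ->
    Rabs (h x' y' z' - h x y z) <= eps).

(** Induction through the recursion takes the place of a uniform convergence argument: each peeled
    term multiplies the tail bound by [mu]. *)
Lemma orbit_series_continuous_upto (N : nat) x y z eps : 0 < eps ->
  exists eta, 0 < eta /\ forall x' y' z',
    dist x x' < eta -> dist y y' < eta -> dist z z' < eta ->
    Rabs (orbit_series F h x' y' z' - orbit_series F h x y z)
    <= eps + mu ^ N / (1 - mu).
Proof.
  assert (Hmu := mu_bounds).
  revert x y z eps. induction N as [|N IH]; intros x y z eps He.
  (* Any radius works: both values lie in an interval of length [/ (1 - mu)]. *)
  - exists 1. split; [lra|]. intros x' y' z' _ _ _.
    assert (H1 := orbit_series_bounds x y z).
    assert (H2 := orbit_series_bounds x' y' z').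
    simpl. unfold Rdiv. rewrite Rmult_1_l. apply Rabs_le. lra.
  (* One half of [eps] pays for the peeled term; the other half, from the shifted series, shrinks
     under the factor [mu]. *)
  - destruct (hc x y z (eps / 2)) as (e1 & He1 & H1); [lra|].
    destruct (IH (F x) (F y) (F z) (eps / 2)) as (e2 & He2 & H2); [lra|].
    destruct (HF x e2 He2) as (ex & Hex & Hx).
    destruct (HF y e2 He2) as (ey & Hey & Hy).
    destruct (HF z e2 He2) as (ez & Hez & Hz).
    exists (Rmin e1 (Rmin ex (Rmin ey ez))).
    split; [repeat apply Rmin_pos; assumption|].
    assert (Hr := Rmin_r e1 (Rmin ex (Rmin ey ez))).
    assert (Hl := Rmin_l e1 (Rmin ex (Rmin ey ez))).
    assert (Hrl := Rmin_l ex (Rmin ey ez)).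
    assert (Hrr := Rmin_r ex (Rmin ey ez)).
    assert (Hrrl := Rmin_l ey ez). assert (Hrrr := Rmin_r ey ez).
    intros x' y' z' Dx Dy Dz.
    specialize (H1 x' y' z' ltac:(lra) ltac:(lra) ltac:(lra)).
    specialize (H2 (F x') (F y') (F z')
      (Hx x' ltac:(lra)) (Hy y' ltac:(lra)) (Hz z' ltac:(lra))).
    rewrite (orbit_series_step x y z), (orbit_series_step x' y' z').
    apply Rabs_le_between in H1. apply Rabs_le_between in H2.
    replace (mu ^ S N / (1 - mu)) with (mu * (mu ^ N / (1 - mu)))
      by (simpl; unfold Rdiv; ring).
    apply Rabs_le. nra.
Qed.

Lemma orbit_series_continuous x y z eps : 0 < eps ->
  exists eta, 0 < eta /\ forall x' y' z',
    dist x x' < eta -> dist y y' < eta -> dist z z' < eta ->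
    Rabs (orbit_series F h x' y' z' - orbit_series F h x y z) < eps.
Proof.
  intros He. assert (Hmu := mu_bounds).
  (* [N] is chosen to bring the tail bound [mu ^ N / (1 - mu)] below [eps / 2]. *)
  destruct (pow_lt_1_zero mu ltac:(rewrite Rabs_pos_eq; lra)
              (eps / 2 * (1 - mu)) ltac:(nra)) as [N HN].
  specialize (HN N (Nat.le_refl N)).
  rewrite Rabs_pos_eq in HN by (apply pow_le; lra).
  destruct (orbit_series_continuous_upto N x y z (eps / 2)) as (eta & Heta & H);
    [lra|].
  exists eta. split; [exact Heta|]. intros x' y' z' Dx Dy Dz.
  eapply Rle_lt_trans; [apply H; assumption|].
  apply Rlt_div_l in HN; lra.
Qed.

End OrbitSeries.

(** * The forward and backward sums combine into a catenary local metric *)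

Theorem mainTheorem19 (X : Type) (dist : X -> X -> R) (f g : X -> X) :
  is_metric dist ->
  compact_space dist ->
  homeomorphism_with_inverse dist f g ->
  expansive dist f g ->
  exists (delta : R) (D : X -> X -> X -> R),
    local_metric dist delta D /\ catenary dist f g delta D.
Proof.
  intros Hm _ (Hf & Hg & Hgf & Hfg) (alpha & Halpha & Hexp).
  (* Vanishing of [collapse] bounds distances by [2 * delta], which must not exceed the expansivity
     constant [alpha]. *)
  set (delta := alpha / 2).
  assert (Hd : 0 < delta) by (unfold delta; lra).
  set (h := collapse dist delta).
  assert (hb : forall x y z, 0 <= h x y z <= 1)
    by exact (collapse_bounds delta Hm).
  assert (hc := collapse_continuous delta Hm).
  assert (Sf0 := fun x y z => orbit_series_bounds f hb x y z).
  assert (Sg0 := fun x y z => orbit_series_bounds g hb x y z).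
  exists delta, (fun x y z => orbit_series f h x y z + orbit_series g h x y z).
  split; [repeat split|].
  - exact Hd.
  - intros x y z _ eps He.
    destruct (orbit_series_continuous f hb Hf hc x y z (eps / 2))
      as (e1 & He1 & H1); [lra|].
    destruct (orbit_series_continuous g hb Hg hc x y z (eps / 2))
      as (e2 & He2 & H2); [lra|].
    exists (Rmin e1 e2). split; [now apply Rmin_pos|].
    assert (Hl := Rmin_l e1 e2). assert (Hr := Rmin_r e1 e2).
    intros x' y' z' _ Dx Dy Dz.
    specialize (H1 x' y' z' ltac:(lra) ltac:(lra) ltac:(lra)).
    specialize (H2 x' y' z' ltac:(lra) ltac:(lra) ltac:(lra)).
    apply Rabs_lt_between in H1. apply Rabs_lt_between in H2.
    apply Rabs_lt_between. lra.
  - intros x y z _ _. specialize (Sf0 x y z). specialize (Sg0 x y z). lra.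
  (* Two nonnegative halves with zero sum both vanish, hence so does [h] at every forward and
     backward iterate, and expansivity applies. *)
  - intros HD. specialize (Sf0 x y z). specialize (Sg0 x y z).
    assert (HP : orbit_series f h x y z = 0) by lra.
    assert (HQ : orbit_series g h x y z = 0) by lra.
    apply Hexp. intros n.
    replace alpha with (2 * delta) by (unfold delta; lra).
    destruct n as [|p|p].
    + apply (collapse_eq0_dist delta Hm x y z Hd).
      exact (orbit_series_eq0 f hb x y z 0 HP).
    + eapply (collapse_eq0_dist delta Hm _ _ _ Hd).
      exact (orbit_series_eq0 f hb x y z _ HP).
    + eapply (collapse_eq0_dist delta Hm _ _ _ Hd).
      exact (orbit_series_eq0 g hb x y z _ HQ).
  - intros <-. rewrite !orbit_series_diag by exact (collapse_diag delta Hm). lra.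
  - intros x y z _ _. unfold orbit_series.
    f_equal; apply Series_ext; intros n; f_equal; apply (collapse_sym delta Hm).
  - intros x y z w _ _ _.
    assert (H1 := orbit_series_triangle f hb x y z w (collapse_triangle delta Hm)).
    assert (H2 := orbit_series_triangle g hb x y z w (collapse_triangle delta Hm)).
    lra.
  - intros x y _. unfold orbit_series.
    f_equal; apply Series_ext; intros n; f_equal;
      now apply (collapse_base delta Hm).
  - intros x y z H0 H1 H2.
    (* With [h] zero at the three consecutive triples, the recursions become purely geometric: with
       [a] and [b] as set below, the forward sums at [f x], [x], [g x] are [a], [mu * a],
       [mu * mu * a], and the backward sums are [mu * mu * b], [mu * b], [b]. *)
    apply (collapse_in_X3 delta Hm) in H0, H1, H2. fold h in H0, H1, H2.
    assert (E1 := orbit_series_step f hb x y z).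
    assert (E2 := orbit_series_step g hb x y z).
    assert (E3 := orbit_series_step f hb (g x) (g y) (g z)).
    assert (E4 := orbit_series_step g hb (f x) (f y) (f z)).
    rewrite !Hfg, H2 in E3. rewrite !Hgf, H1 in E4. rewrite H0 in E1, E2.
    rewrite E3, E4, E1, E2. assert (Hr := mu_root).
    set (a := orbit_series f h (f x) (f y) (f z)).
    set (b := orbit_series g h (g x) (g y) (g z)).
    (* The equation for [mu] turns this factor into [mu], and [mu * (a + b)] is the value at [x]. *)
    transitivity ((mu * mu - 2 * mu + 1) * (a + b)); [|rewrite Hr]; ring.
Qed.
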